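(* Let $p\in\{1,\dots,n\}$. If $f\colon\mathbb{B}^n\to\mathbb{R}$ is symmetric, then $f$ is $p$-locally monotone if and only if $f$ has $p$-permutable lattice derivatives.
   Context: $\mathbb{B}=\{0,1\}$, $[n]=\{1,\dots,n\}$. A function is symmetric if it is invariant under all permutations of its variables. For $k\in[n]$, $\mathbf{x}\in\mathbb{B}^n$, $a\in\mathbb{B}$, $\mathbf{x}_k^a$ is the tuple obtained from $\mathbf{x}$ by replacing its $k$-th component by $a$; $\Delta_kf(\mathbf{x})=f(\mathbf{x}_k^1)-f(\mathbf{x}_k^0)$. The function $f$ is $p$-locally monotone if for every $k\in[n]$ and all $\mathbf{x},\mathbf{y}\in\mathbb{B}^n$ with $\sum_{i\in[n]\setminus\{k\}}|x_i-y_i|<p$ we have $\Delta_kf(\mathbf{x})\,\Delta_kf(\mathbf{y})\geq 0$. The lattice derivatives are $\wedge_kf,\vee_kf\colon\mathbb{B}^n\to\mathbb{R}$, $\wedge_kf(\mathbf{x})=\min(f(\mathbf{x}_k^0),f(\mathbf{x}_k^1))$, $\vee_kf(\mathbf{x})=\max(f(\mathbf{x}_k^0),f(\mathbf{x}_k^1))$. The function $f$ has $p$-permutable lattice derivatives if for every $p$-subset $\{k_1,\dots,k_p\}\subseteq[n]$, every choice of operators $O_{k_i}\in\{\wedge_{k_i},\vee_{k_i}\}$ ($i=1,\dots,p$) and every permutation $\pi$ of $\{1,\dots,p\}$, we have $O_{k_1}\cdots O_{k_p}f=O_{k_{\pi(1)}}\cdots O_{k_{\pi(p)}}f$ (operators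 applied right to left). *)

(* Defs.v *)
From mathcomp Require Import all_boot all_order all_algebra all_fingroup.
From mathcomp Require Import reals.

Set Implicit Arguments.
Unset Strict Implicit.
Unset Printing Implicit Defensive.

Import Order.TTheory GRing.Theory Num.Theory.
Local Open Scope ring_scope.

Definition cube (n : nat) : predArgType := {ffun 'I_n -> bool}.

Definition symmetric_fun (R : realType) (n : nat) (f : cube n -> R) : Prop :=
  forall (s : 'S_n) (x : cube n), f [ffun i => x (s i)] = f x.

Definition upd (n : nat) (x : cube n) (k : 'I_n) (a : bool) : cube n :=
  [ffun i => if i == k then a else x i].

Definition Delta (R : realType) (n : nat) (k : 'I_n) (f : cube n -> R) :
    cube n -> R :=
  fun x => f (upd x k true) - f (upd x k false).

Definition locally_monotone (R : realType) (n p : nat) (f : cube n -> R) :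
    Prop :=
  forall (k : 'I_n) (x y : cube n),
    \sum_(i < n | i != k) `|(x i)%:R - (y i)%:R| < p%:R :> int ->
    0 <= Delta k f x * Delta k f y.

Definition meet_deriv (R : realType) (n : nat) (k : 'I_n) (f : cube n -> R) :
    cube n -> R :=
  fun x => Num.min (f (upd x k false)) (f (upd x k true)).

Definition join_deriv (R : realType) (n : nat) (k : 'I_n) (f : cube n -> R) :
    cube n -> R :=
  fun x => Num.max (f (upd x k false)) (f (upd x k true)).

Definition lattice_deriv (R : realType) (n : nat) (b : bool) (k : 'I_n) :
    (cube n -> R) -> (cube n -> R) :=
  if b then @join_deriv R n k else @meet_deriv R n k.

(* [iter_deriv O k f] is O_{k_1} ... O_{k_p} f, the rightmost operator being
   applied first. *)
Definition iter_deriv (R : realType) (n p : nat) (O : 'I_p -> bool)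
    (k : 'I_p -> 'I_n) (f : cube n -> R) : cube n -> R :=
  foldr (fun i g => lattice_deriv (O i) (k i) g) f (enum 'I_p).

(* A p-subset {k_1, ..., k_p} is given by an injective enumeration [k]; the
   operator chosen for k_i is [O i], and it moves along with k_i under the
   permutation [s]. *)
Definition permutable_lattice_derivs (R : realType) (n p : nat)
    (f : cube n -> R) : Prop :=
  forall (k : 'I_p -> 'I_n) (O : 'I_p -> bool) (s : 'S_p),
    injective k ->
    iter_deriv O k f =1 iter_deriv (O \o s) (k \o s) f.

(* Main.v *)
Require Import Defs.
From mathcomp Require Import all_boot all_order all_algebra all_fingroup.
From mathcomp Require Import reals zify.

(** A symmetric function is [f x = g |x|] for a sequence [g] on [{0, ..., n}],
    and a lattice derivative replaces [g] by the sequence of minima or maxima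
    of consecutive terms.  Both properties are thus about windows
    [g m, ..., g (m + p)]: local monotonicity says that each window is
    monotone, permutability that a word of [p] operators, evaluated at [m],
    depends only on its number of joins.  On a monotone window, a word with [j]
    joins selects the [j]-th smallest term.  Conversely, fix a threshold [c]
    and let [j] be the length of the longest run of terms [< c] in the window.
    The minimum of the maxima over [j + 1] consecutive terms is then [>= c];
    permutability makes the maximum of the minima over [p - j + 1] consecutive
    terms [>= c] as well, so there is a run of [p - j + 1] terms [>= c], and the
    two runs fill the window.  As this holds for every [c], the window is
    monotone. *)

Section Proofs.

Set Implicit Arguments.
Unset Strict Implicit.

Import Order.TTheory GRing.Theory Num.Theory.
Local Open Scope ring_scope.

(** * Lattice derivatives on sequences *)

Definition seq_deriv {R : realDomainType} (b : bool) (g : nat -> R) : nat -> R :=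
  fun m => if b then Num.max (g m) (g m.+1) else Num.min (g m) (g m.+1).

Definition seq_derivs {R : realDomainType} (w : seq bool) (g : nat -> R) :
    nat -> R :=
  foldr seq_deriv g w.

(** By induction, the tail of the word yields two consecutive terms of [g] at [m] and [m + 1]. They
    are in order, so a join at the head advances the index by one and a meet keeps it. *)
Lemma seq_derivs_nondecr (R : realDomainType) (w : seq bool) (g : nat -> R)
    (m : nat) :
  (forall i, (i < size w)%N -> g (m + i)%N <= g (m + i).+1) ->
  seq_derivs w g m = g (m + count id w)%N.
Proof.
elim: w m => [|b w IHw] m mono /=; first by rewrite addn0.
have step1 : seq_derivs w g m = g (m + count id w)%N.
  by apply: IHw => i ltiw; apply: mono; apply: ltnW.
have step2 : seq_derivs w g m.+1 = g (m + count id w).+1.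
  by rewrite IHw ?addSn // => i ltiw; rewrite !addSnnS; apply: mono.
have le_step : g (m + count id w)%N <= g (m + count id w).+1.
  by apply: mono; rewrite /= ltnS count_size.
rewrite /seq_deriv -!/(seq_derivs w g) step1 step2; case: b {mono} => /=.
- by rewrite max_r // add1n addnS.
- by rewrite min_l.
Qed.

Lemma seq_derivs_noninc (R : realDomainType) (w : seq bool) (g : nat -> R)
    (m : nat) :
  (forall i, (i < size w)%N -> g (m + i).+1 <= g (m + i)%N) ->
  seq_derivs w g m = g (m + count negb w)%N.
Proof.
elim: w m => [|b w IHw] m mono /=; first by rewrite addn0.
have step1 : seq_derivs w g m = g (m + count negb w)%N.
  by apply: IHw => i ltiw; apply: mono; apply: ltnW.
have step2 : seq_derivs w g m.+1 = g (m + count negb w).+1.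
  by rewrite IHw ?addSn // => i ltiw; rewrite !addSnnS; apply: mono.
have le_step : g (m + count negb w).+1 <= g (m + count negb w)%N.
  by apply: mono; rewrite /= ltnS count_size.
rewrite /seq_deriv -!/(seq_derivs w g) step1 step2; case: b {mono} => /=.
- by rewrite max_l.
- by rewrite min_r // add1n addnS.
Qed.

(** A threshold [c] turns maxima and minima into quantifiers, so that only the Boolean sequence
    [c <= g _] matters. *)
Lemma le_seq_derivs_join (R : realDomainType) (c : R) (j m : nat)
    (w : seq bool) (g : nat -> R) :
  c <= seq_derivs (nseq j true ++ w) g m <->
  exists2 l, (l <= j)%N & c <= seq_derivs w g (m + l)%N.
Proof.
elim: j m => [|j IHj] m /=.
  split=> [cle|[l]]; first by exists 0%N; rewrite ?addn0.
  by rewrite leqn0 => /eqP->; rewrite addn0.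
rewrite /seq_deriv -!/(seq_derivs _ g) le_max; split.
  case/orP => /IHj[l lel cle]; first by exists l; rewrite // leqW.
  by exists l.+1; rewrite // addnS.
case=> [[|l] lel cle]; apply/orP.
  by left; apply/IHj; exists 0%N.
by right; apply/IHj; exists l; rewrite // addSnnS.
Qed.

Lemma le_seq_derivs_meet (R : realDomainType) (c : R) (i m : nat)
    (w : seq bool) (g : nat -> R) :
  c <= seq_derivs (nseq i false ++ w) g m <->
  forall l, (l <= i)%N -> c <= seq_derivs w g (m + l)%N.
Proof.
elim: i m => [|i IHi] m /=.
  split=> [cle l|]; last by move=> /(_ 0%N isT); rewrite addn0.
  by rewrite leqn0 => /eqP->; rewrite addn0.
rewrite /seq_deriv -!/(seq_derivs _ g) le_min; split.
  case/andP => /IHi cle0 /IHi cle1 [|l] lel; first exact: cle0.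
  by rewrite -addSnnS; apply: cle1.
move=> cle; apply/andP; split; apply/IHi => l lel; first by apply/cle/leqW.
by rewrite addSnnS; apply: cle.
Qed.

(** * Permutation invariance and monotone windows *)

Definition perm_invariant {R : realDomainType} (p : nat) (g : nat -> R)
    (m : nat) : Prop :=
  forall w w', size w = p -> perm_eq w w' -> seq_derivs w g m = seq_derivs w' g m.

(** On the window, [c <= g _] has at most one run of each truth value, so it changes at most
    once. *)
Lemma perm_invariant_threshold (R : realDomainType) (g : nat -> R)
    (m p i1 i2 i3 : nat) (c : R) :
  perm_invariant p g m -> (i1 < i2)%N -> (i2 < i3)%N -> (i3 <= p)%N ->
  (c <= g (m + i1)%N) = (c <= g (m + i3)%N) ->
  (c <= g (m + i2)%N) = (c <= g (m + i1)%N).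
Proof.
move=> inv lt12 lt23 le3p h13.
have [//|h12] := eqVneq (c <= g (m + i2)%N) (c <= g (m + i1)%N).
(* The least [j] with [cov j] is the length of the longest run of terms [< c]. *)
pose cov j := [forall l : 'I_(p - j).+1, exists l' : 'I_j.+1,
  c <= g (m + l + l')%N].
have covp : cov p.
  apply/forallP => -[l0 ltl0] /=; have -> : l0 = 0%N by lia.
  have [l lelp cl] : exists2 l, (l <= p)%N & c <= g (m + l)%N.
    case h1: (c <= g (m + i1)%N); first by exists i1; lia.
    by move: h12; rewrite h1 eqbF_neg negbK; exists i2; lia.
  by apply/existsP; exists (Ordinal (lelp : (l < p.+1)%N)); rewrite /= addn0.
case: (ex_minnP (ex_intro _ p covp)) => j covj minj.
have lejp := minj p covp.
have [l'' lel'' ones] : exists2 l, (l <= j)%N &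
    forall r, (r <= p - j)%N -> c <= g (m + l + r)%N.
  have : c <= seq_derivs (nseq j true ++ nseq (p - j) false) g m.
    (* With the meets in front, the value is a minimum of maxima, which [cov j] bounds below by
       [c]. *)
    rewrite (inv _ (nseq (p - j) false ++ nseq j true)); first last.
    - by rewrite perm_catC.
    - by rewrite size_cat !size_nseq; lia.
    apply/le_seq_derivs_meet => l lel; rewrite -[nseq j _]cats0.
    apply/le_seq_derivs_join.
    have /existsP[[l' ltl'] cl] := forallP covj (Ordinal (lel : (l < _.+1)%N)).
    by exists l'.
  case/le_seq_derivs_join => l lel; rewrite -[nseq _ _]cats0.
  by move/le_seq_derivs_meet => ones; exists l.
case: j => [|j] in covj minj lejp lel'' ones *.
  have l0 : l'' = 0%N by lia.
  have one i : (i <= p)%N -> c <= g (m + i)%N.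
    by move=> leip; have := ones i; rewrite l0 addn0 subn0; apply.
  by rewrite !one //; lia.
(* The least index is now [j.+1], so some block of [j.+1] terms violates [cov j]. *)
have [l lel zeros] : exists2 l, (l <= p - j)%N &
    forall r, (r <= j)%N -> (c <= g (m + l + r)%N) = false.
  have : ~~ cov j by apply/negP => /minj; rewrite ltnn.
  case/forallPn => -[l ltl] /existsPn zeros; exists l => // r ler.
  exact/negbTE/(zeros (Ordinal (ler : (r < j.+1)%N))).
have one i : (l'' <= i <= l'' + (p - j.+1))%N -> c <= g (m + i)%N.
  by move=> ?; have := ones (i - l'')%N; rewrite -addnA subnKC; [apply|]; lia.
have zero i : (l <= i <= l + j)%N -> (c <= g (m + i)%N) = false.
  by move=> ?; have := zeros (i - l)%N; rewrite -addnA subnKC; [apply|]; lia.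
(* Overlapping runs would share the larger of their left ends. *)
have disj : (l'' + (p - j.+1) < l)%N || (l + j < l'')%N.
  apply: contraT => overlap; have := zero (maxn l l''); rewrite one; lia.
(* The runs have [j + 1] and [p - j] terms; being disjoint, they fill the [p + 1] terms of the
   window. *)
have val i : (i <= p)%N -> (c <= g (m + i)%N) = ~~ (l <= i <= l + j)%N.
  by move=> leip; have [/zero->|out] := boolP (_ <= _ <= _)%N; rewrite // one //; lia.
move: h13 h12; rewrite !val; lia.
Qed.

(** If the steps at [a] and [b] have opposite signs, some threshold separates [b] or [a + 1] from
    both ends [a] and [b + 1]. *)
Lemma perm_invariant_monotone (R : realDomainType) (g : nat -> R)
    (m p a b : nat) :
  perm_invariant p g m -> (a < b)%N -> (b < p)%N ->
  0 <= (g (m + a).+1 - g (m + a)%N) * (g (m + b).+1 - g (m + b)%N).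
Proof.
move=> inv ltab ltbp.
have thr_a c : (c <= g (m + a)%N) = (c <= g (m + b).+1) ->
    (c <= g (m + a).+1) = (c <= g (m + a)%N).
  by rewrite -!addnS; apply: perm_invariant_threshold inv _ _ _.
have thr_b c : (c <= g (m + a)%N) = (c <= g (m + b).+1) ->
    (c <= g (m + b)%N) = (c <= g (m + a)%N).
  by rewrite -!addnS; apply: perm_invariant_threshold inv _ _ _.
have [up_a|down_a|->] := ltrgtP (g (m + a)%N) (g (m + a).+1); last first.
- by rewrite subrr mul0r.
- have [up_b|down_b|->] := ltrgtP (g (m + b)%N) (g (m + b).+1); last first.
  + by rewrite subrr mulr0.
  + by rewrite mulr_le0 // subr_le0 ltW.
  (* The term below both ends is at [b] if it is lower than the one at [a], and at [a + 1]
     otherwise. *)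
  have [ltba|leab] := ltP (g (m + b)%N) (g (m + a)%N).
    have := thr_b (Num.min (g (m + a)%N) (g (m + b).+1)).
    rewrite !ge_min !lexx ?orbT /= => /(_ erefl).
    by rewrite !leNgt ltba up_b.
  have := thr_a (g (m + a)%N); rewrite lexx (le_trans leab (ltW up_b)).
  by move=> /(_ erefl); rewrite leNgt down_a.
- have [up_b|down_b|->] := ltrgtP (g (m + b)%N) (g (m + b).+1); last first.
  + by rewrite subrr mulr0.
  (* Dually, the term above both ends is at [b] or at [a + 1]. *)
  + have [ltab'|leba] := ltP (g (m + a)%N) (g (m + b)%N).
      have := thr_b (g (m + b)%N); rewrite lexx !leNgt ltab' down_b.
      by move=> /(_ erefl).
    have := thr_a (g (m + a).+1); rewrite lexx !leNgt up_a.
    by rewrite (lt_trans (lt_le_trans down_b leba) up_a) => /(_ erefl).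
  by rewrite mulr_ge0 // subr_ge0 ltW.
Qed.

(** One strict descent forces every step of the window to be nonincreasing; without any, all steps
    are nondecreasing. *)
Lemma monotone_perm_invariant (R : realDomainType) (g : nat -> R) (m p : nat) :
  (forall a b, (a < p)%N -> (b < p)%N ->
    0 <= (g (m + a).+1 - g (m + a)%N) * (g (m + b).+1 - g (m + b)%N)) ->
  perm_invariant p g m.
Proof.
move=> mono w w' sw eqww'; have sw' := perm_size eqww'.
have /seq.permP eqcount := eqww'.
case: (pickP (fun i : 'I_p => g (m + i).+1 < g (m + i)%N)) => [a down_a|up].
  have down i : (i < p)%N -> g (m + i).+1 <= g (m + i)%N.
    move=> ltip; have := mono a i (ltn_ord a) ltip.
    by rewrite nmulr_rge0 ?subr_lt0 // subr_le0.
  by rewrite !seq_derivs_noninc -?sw' ?sw ?eqcount.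
have {}up i : (i < p)%N -> g (m + i)%N <= g (m + i).+1.
  by move=> ltip; rewrite leNgt (up (Ordinal ltip)).
by rewrite !seq_derivs_nondecr -?sw' ?sw ?eqcount.
Qed.

(** * Symmetric functions as sequences *)

Definition weight {n : nat} (P : pred 'I_n) (x : cube n) : nat :=
  (\sum_(i < n | P i) x i)%N.

(** Taking prefixes of one enumeration makes the slices nested, so their Hamming distance is the
    difference of their weights. *)
Definition slice {n : nat} (P : pred 'I_n) (m : nat) : cube n :=
  [ffun i => i \in take m (enum P)].

Lemma weight_slice (n : nat) (P : pred 'I_n) (m : nat) :
  (m <= #|P|)%N -> weight P (slice P m) = m.
Proof.
move=> lem; rewrite /weight.
rewrite (eq_bigr (fun i => if i \in take m (enum P) then 1 else 0)%N); last first.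
  by move=> i _; rewrite ffunE; case: ifP.
rewrite -big_mkcondr sum1_card.
rewrite (@eq_card _ _ (mem (take m (enum P)))) => [|i]; last first.
  by apply: andb_idl => /mem_take; rewrite mem_enum.
by rewrite (card_uniqP _) ?take_uniq ?enum_uniq // size_take_min -cardE; apply/minn_idPl.
Qed.

Lemma weight_le (n : nat) (P : pred 'I_n) (x : cube n) : (weight P x <= #|P|)%N.
Proof. by rewrite -sum1_card; apply: leq_sum => i _; case: (x i). Qed.

Lemma eq_weight (n : nat) (P Q : pred 'I_n) (x : cube n) :
  P =1 Q -> weight P x = weight Q x.
Proof. exact: eq_bigl. Qed.

Lemma weight_upd (n : nat) (P : pred 'I_n) (x : cube n) (k : 'I_n) (a : bool) :
  P k -> weight P (upd x k a) = (a + weight (fun i => P i && (i != k)) x)%N.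
Proof.
move=> Pk; rewrite /weight (bigD1 k) //= ffunE eqxx; congr (_ + _)%N.
by apply: eq_bigr => i /andP[_ /negbTE neik]; rewrite ffunE neik.
Qed.

(** Points of equal weight have the same multiset of bits, so a permutation of the coordinates
    carries one to the other. *)
Lemma symmetric_weight (R : realType) (n : nat) (f : cube n -> R)
    (x y : cube n) :
  symmetric_fun f -> weight predT x = weight predT y -> f x = f y.
Proof.
move=> symf eqw.
have countE (z : cube n) : count id [tuple z i | i < n] = weight predT z.
  by rewrite /weight -sum1_count big_map big_mkcond /= big_enum.
have /tuple_permP[s eqxy] : perm_eq [tuple x i | i < n] [tuple y i | i < n].
  apply/seq.permP => a.
  have countD (t : seq bool) :
      count a t = (a true * count id t + a false * (size t - count id t))%N.
    elim: t => [|b t IHt] /=; first by lia.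
    by have := count_size id t; rewrite IHt; case: b => /=; lia.
  by rewrite !countD !countE eqw !size_tuple.
rewrite -(symf s y); congr f; apply/ffunP => i; rewrite ffunE.
move/val_inj/(congr1 (fun t => tnth t i)): eqxy.
by rewrite !tnth_mktuple.
Qed.

(** This is the [g] with [f x = g |x|]; beyond [n] it keeps the value of [f] at the all-ones
    point. *)
Definition layers {R : realType} {n : nat} (f : cube n -> R) (m : nat) : R :=
  f (slice predT m).

Lemma symmetric_layers (R : realType) (n : nat) (f : cube n -> R) (x : cube n) :
  symmetric_fun f -> f x = layers f (weight predT x).
Proof.
by move=> symf; apply: symmetric_weight symf _; rewrite weight_slice ?weight_le.
Qed.

(** Setting the coordinate [k i] of the outermost operator to 0 or 1 gives consecutive weights off
    the remaining list, hence one derivative of the sequence. *)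
Lemma foldr_lattice_deriv (R : realType) (n : nat) (f : cube n -> R) (I : Type)
    (O : I -> bool) (k : I -> 'I_n) (s : seq I) (x : cube n) :
  symmetric_fun f -> uniq (map k s) ->
  foldr (fun i g => lattice_deriv (O i) (k i) g) f s x =
  seq_derivs (map O s) (layers f) (weight (fun i => i \notin map k s) x).
Proof.
move=> symf; elim: s x => [|i s IHs] x /=.
  by move=> _; apply: symmetric_layers.
case/andP => nki uks; rewrite /seq_deriv -/(seq_derivs _ _).
have wE b : weight (fun j => j \notin map k s) (upd x (k i) b) =
    (b + weight (fun j => j \notin k i :: map k s) x)%N.
  rewrite weight_upd //; congr (_ + _)%N; apply: eq_weight => j.
  by rewrite inE negb_or andbC.
by case: (O i); rewrite /= /join_deriv /meet_deriv !IHs // !wE.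
Qed.

Lemma iter_deriv_layers (R : realType) (n p : nat) (f : cube n -> R)
    (O : 'I_p -> bool) (k : 'I_p -> 'I_n) (x : cube n) :
  symmetric_fun f -> injective k ->
  iter_deriv O k f x =
  seq_derivs (map O (enum 'I_p)) (layers f) (weight (fun i => i \notin codom k) x).
Proof.
move=> symf injk; rewrite /iter_deriv foldr_lattice_deriv //.
by rewrite map_inj_uniq ?enum_uniq.
Qed.

Lemma card_notin_codom (n p : nat) (k : 'I_p -> 'I_n) :
  injective k -> #|fun i => i \notin codom k| = (n - p)%N.
Proof.
move=> injk; have := cardC (mem (codom k)); rewrite card_codom // !card_ord.
by move=> /(congr1 (subn^~ p)); rewrite addKn.
Qed.

Lemma weight_codom_perm (n p : nat) (k : 'I_p -> 'I_n) (s : 'S_p) (x : cube n) :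
  weight (fun i => i \notin codom (k \o s)) x =
  weight (fun i => i \notin codom k) x.
Proof.
apply: eq_weight => i; congr (~~ _).
apply/codomP/codomP => -[j ->]; first by exists (s j).
by exists (s^-1%g j); rewrite /= permKV.
Qed.

(** * Both properties in terms of windows *)

Lemma permutable_layers (R : realType) (n p : nat) (f : cube n -> R) :
  (p <= n)%N -> symmetric_fun f ->
  permutable_lattice_derivs p f <->
  (forall m, (m + p <= n)%N -> perm_invariant p (layers f) m).
Proof.
move=> lepn symf; split=> [permf m lemp w w' sw | inv k O s injk x].
  rewrite -{}sw in permf lepn lemp *.
  rewrite perm_sym => eqw; have sw' := perm_size eqw.
  (* The permutation of positions between the two words is the one to feed to [permf]. *)
  have /tuple_permP[s defw'] : perm_eq (Tuple (introT eqP sw')) (in_tuple w).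
    by [].
  pose k := widen_ord lepn.
  have injk : injective k by move=> i j /(congr1 val) /= /val_inj.
  (* With [m] true coordinates off the image of [k], the derivatives at [x] read the window starting
     at [m]. *)
  pose x := slice (fun i => i \notin codom k) m.
  have := permf k (tnth (in_tuple w)) s injk x.
  rewrite !iter_deriv_layers //; last by apply: inj_comp => //; apply: perm_inj.
  rewrite weight_codom_perm weight_slice; last by rewrite card_notin_codom //; lia.
  rewrite map_tnth_enum /= => ->; congr seq_derivs.
  by move: defw' => /= ->; rewrite -[RHS]/(map _ _) enumT.
rewrite !iter_deriv_layers //; last by apply: inj_comp => //; apply: perm_inj.
rewrite weight_codom_perm.
apply: inv; [|by rewrite size_map size_enum_ord|].
  by have := weight_le (fun i => i \notin codom k) x; rewrite card_notin_codom //; lia.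
rewrite (map_comp O s); apply: perm_map; rewrite perm_sym; apply: uniq_perm; rewrite ?enum_uniq //.
  by rewrite map_inj_uniq ?enum_uniq //; apply: perm_inj.
move=> i; rewrite mem_enum; apply/mapP; exists (s^-1%g i); rewrite ?mem_enum //.
by rewrite permKV.
Qed.

Lemma Delta_layers (R : realType) (n : nat) (f : cube n -> R) (k : 'I_n)
    (x : cube n) :
  symmetric_fun f ->
  Delta k f x = layers f (weight (predC1 k) x).+1 - layers f (weight (predC1 k) x).
Proof.
by move=> symf; rewrite /Delta !(symmetric_layers _ symf) !weight_upd.
Qed.

(** Off [k], the distance of two points is at least the difference of their weights, with equality
    for nested slices. *)
Lemma locally_monotone_layers (R : realType) (n p : nat) (f : cube n -> R) :
  symmetric_fun f ->
  locally_monotone p f <->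
  (forall a b, (a <= b < n)%N -> (b - a < p)%N ->
    0 <= (layers f a.+1 - layers f a) * (layers f b.+1 - layers f b)).
Proof.
move=> symf; split=> [monof a b /andP[leab ltbn] ltp | mono k x y].
  case: n => // n in f symf monof ltbn *.
  pose k : 'I_n.+1 := ord0; have cardk : #|predC1 k| = n by rewrite cardC1 card_ord.
  have := monof k (slice (predC1 k) a) (slice (predC1 k) b).
  rewrite !Delta_layers // !weight_slice ?cardk; [|lia|lia]; apply.
  rewrite (eq_bigr (fun i => (slice (predC1 k) b i)%:R - (slice (predC1 k) a i)%:R));
    last first.
    move=> i _; rewrite distrC ger0_norm // subr_ge0 ler_nat !ffunE.
    have := @mem_take a _ (take b (enum (predC1 k))) i.
    by rewrite take_takel //; do 2 case: (_ \in _) => //; move=> /(_ isT).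
  rewrite sumrB -!natr_sum.
  rewrite -!/(weight (predC1 k) _) !weight_slice ?cardk; lia.
set S := \sum_(_ < n | _) _ => ltSp; rewrite !Delta_layers //.
have leS : `|(weight (predC1 k) x)%:R - (weight (predC1 k) y)%:R| <= S.
  by rewrite !natr_sum -sumrB; apply: ler_norm_sum.
have wlt z : (weight (predC1 k) z < n)%N.
  have := weight_le (predC1 k) z; rewrite cardC1 card_ord.
  by have := ltn_ord k; lia.
have := wlt x; have := wlt y; move: leS ltSp.
case: (leqP (weight (predC1 k) x) (weight (predC1 k) y)) => *.
  by apply: mono; lia.
by rewrite mulrC; apply: mono; lia.
Qed.

End Proofs.

Theorem theorem27 (R : realType) (n p : nat) (f : cube n -> R) :
  0 < p <= n ->
  symmetric_fun f ->
  locally_monotone p f <-> permutable_lattice_derivs p f.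
Proof.
move=> /andP[_ lepn] symf.
rewrite permutable_layers // locally_monotone_layers //; split=> [mono m lemp | inv a b].
  apply: monotone_perm_invariant => a b ltap ltbp.
  case: (leqP a b) => *; first by apply: mono; lia.
  by rewrite GRing.mulrC; apply: mono; lia.
case/andP; rewrite leq_eqVlt => /predU1P[-> _ _ | ltab ltbn ltp].
  by rewrite -GRing.expr2 Num.Theory.sqr_ge0.
(* The window starts at [a] unless it would then overrun [n]; either way it contains [b + 1]. *)
pose m := minn a (n - p).
have := @perm_invariant_monotone _ (layers f) m p (a - m) (b - m).
have -> : m + (a - m) = a by rewrite /m; lia.
have -> : m + (b - m) = b by rewrite /m; lia.
by apply; [apply: inv | |]; rewrite /m; lia.
Qed.
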